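(* Let $n\ge 4$ and let $L_n$ be a simple graph whose vertex set is the disjoint union of the $n+1$ subsets $\{a_1,a_2,\dots,a_n\}$ (with $a_1,\dots,a_n$ distinct), $X_1,\dots,X_n$, satisfying the following conditions: (1) $X_1,X_2,X_3,X_4$ are nonempty (the other $X_i$ may be empty). (2) For every $k=1,2,\dots,n$, the vertex $a_k$ is adjacent to $a_3$ or to $a_4$. (3) $a_i$ and $a_j$ are adjacent whenever $i\ne j$, $X_i\neq\emptyset$ and $X_j\ne\emptyset$. (4) For every $j=1,\dots,n$, $a_j$ is adjacent to each vertex of $X_j$. (5) For $i\neq j$ there is no edge between a vertex of $X_i$ and a vertex of $X_j$. (6) For $i\ne j$ there is no edge between $a_i$ and a vertex of $X_j$. (7) The edges inside each $X_i$ are arbitrary (the graph structures of the subgraphs induced on the $X_i$ can be chosen freely). Then for every commutative semigroup $S$ with zero element, the zero-divisor graph $\Gamma(S)$ is not isomorphic to $L_n$.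
   Context: A semigroup is written multiplicatively, and its zero element $0$ satisfies $0x=0$ for all $x$. An element $x$ of a commutative semigroup $S$ with $0$ is a zero-divisor if $xy=0$ for some $y\in S$ with $y\ne 0$. The zero-divisor graph $\Gamma(S)$ is the undirected simple graph whose vertices are the nonzero zero-divisors of $S$, two distinct vertices $x,y$ being adjacent if and only if $xy=0$. *)

(* Defs.v *)
From mathcomp Require Import all_boot.
From mathcomp Require Import classical_sets.

Set Implicit Arguments.
Unset Strict Implicit.
Unset Printing Implicit Defensive.

Local Open Scope group_scope.
Local Open Scope classical_set_scope.

(* Vertex sets may be infinite and adjacency need not be decidable. *)
Record simple_graph := SimpleGraph {
  vertex :> Type;
  adj : vertex -> vertex -> Prop;
  adj_irrefl : forall x, ~ adj x x;
  adj_sym : forall x y, adj x y -> adj y x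
}.

Definition isomorphic (G H : simple_graph) : Prop :=
  exists2 f : G -> H, bijective f & forall x y, adj x y <-> adj (f x) (f y).

(* Over [magmaType] rather than [semigroupType], because the latter requires
   the carrier to be a choiceType.  The zero is an explicit argument. *)
Record com_semigroup_with_zero (S : magmaType) (zero : S) : Prop := {
  csz_mulA : associative (@mul S);
  csz_mulC : commutative (@mul S);
  csz_mul0 : left_zero zero (@mul S)
}.

Section ZeroDivisorGraph.
Variables (S : magmaType) (zero : S) (S0 : com_semigroup_with_zero zero).

Definition zero_divisor (x : S) : Prop := exists2 y : S, y <> zero & x * y = zero.

Definition zdg_vertex : Type := {x : S | x <> zero /\ zero_divisor x}.

Definition zdg_adj (x y : zdg_vertex) : Prop :=
  x <> y /\ sval x * sval y = zero.

Lemma zdg_adj_irrefl x : ~ zdg_adj x x.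
Proof. by case. Qed.

Lemma zdg_adj_sym x y : zdg_adj x y -> zdg_adj y x.
Proof.
case=> xy xy0; split; first by move=> yx; apply: xy.
by rewrite (csz_mulC S0).
Qed.

Definition zero_divisor_graph : simple_graph :=
  SimpleGraph zdg_adj_irrefl zdg_adj_sym.

End ZeroDivisorGraph.

(* Indices are shifted by one: the element of value [k] of ['I_n] stands for
   the index [k + 1], so [Ordinal n4] is the index 4 and [Ordinal (ltnW n4)]
   is the index 3.  No field constrains the edges inside a single [X i], nor
   (beyond [L_a34] and [L_aa]) the edges between the [a i]. *)
Record is_L (n : nat) (n4 : 4 <= n) (L : simple_graph)
    (a : 'I_n -> L) (X : 'I_n -> set L) : Prop := {
  L_a_inj : injective a;
  L_X_disj : forall i j, i <> j -> X i `&` X j = set0;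
  L_aX_disj : forall i, range a `&` X i = set0;
  L_cover : range a `|` \bigcup_i X i = setT;
  L_X_nonempty : forall i : 'I_n, i < 4 -> X i !=set0;
  L_a34 : forall k, adj (a k) (a (Ordinal (ltnW n4))) \/
                    adj (a k) (a (Ordinal n4));
  L_aa : forall i j, i <> j -> X i !=set0 -> X j !=set0 -> adj (a i) (a j);
  L_aX : forall j x, X j x -> adj (a j) x;
  L_XX : forall i j x y, i <> j -> X i x -> X j y -> ~ adj x y;
  L_aXn : forall i j x, i <> j -> X j x -> ~ adj (a i) x
}.

(* Main.v *)
Require Import Defs.
From mathcomp Require Import all_boot.
From mathcomp Require Import classical_sets.

(** Name each vertex of [L] by the nonzero zero-divisor it corresponds to, and
    pick a vertex [x_i] in each of [X_1], ..., [X_4].  Two remarks on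
    annihilation locate products in the graph.  A vertex annihilated by [x_j]
    is [a_j] or lies in [X_j] ([annihilated_by_X]); hence no vertex is
    annihilated by both [x_j] and [x_c] when [j <> c].  A vertex annihilated by
    two distinct [a_i] is itself some [a_k] ([annihilated_by_two_a]), since an
    element of [X_k] is adjacent to no other [a_i] than [a_k].

    The vertices [x_1] and [x_2] are not adjacent, so [x_1 x_2] is nonzero.  It
    is annihilated by [a_1] and [a_2], hence is some [a_k], and is therefore
    annihilated by [a_c] with [c = 3] or [c = 4].  Now [x_1 a_c] is nonzero,
    because [x_1] and [a_c] are not adjacent, but it is annihilated by [x_2], as
    [x_1 x_2 a_c = 0], and by [x_c], as [a_c x_c = 0].  No vertex has both
    properties. *)

Set Implicit Arguments.
Unset Strict Implicit.
Unset Printing Implicit Defensive.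

Local Open Scope group_scope.
Local Open Scope classical_set_scope.

(** Everything the proof needs from an isomorphism of the zero-divisor graph
    with [L], expressed by products in [S].  A vertex may square to zero without
    being adjacent to itself, so [label_adj] is restricted to distinct
    vertices. *)
Record zero_divisor_labelling (L : simple_graph) (S : magmaType) (zero : S)
    (v : L -> S) : Prop := {
  label_neq0 : forall p, v p <> zero;
  label_mul0 : forall p q, adj p q -> v p * v q = zero;
  label_adj : forall p q, p <> q -> v p * v q = zero -> adj p q;
  label_onto : forall s t, s <> zero -> t <> zero -> s * t = zero ->
    exists p, v p = s
}.

Lemma isomorphic_labelling (L : simple_graph) (S : magmaType) (zero : S)
    (S0 : com_semigroup_with_zero zero) :
  isomorphic (zero_divisor_graph S0) L ->
  exists v : L -> S, zero_divisor_labelling zero v.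
Proof.
case=> f [g fK gK] fadj; exists (fun p => sval (g p)); split.
- by move=> p; case: (svalP (g p)).
- by move=> p q; rewrite -{1}(gK p) -{1}(gK q) => /fadj[].
- move=> p q pq pq0; rewrite -(gK p) -(gK q); apply/fadj.
  by split=> // /(congr1 f); rewrite !gK.
- move=> s t s0 t0 st0.
  have sP : s <> zero /\ zero_divisor zero s by split=> //; exists t.
  by exists (f (exist _ s sP)); rewrite fK.
Qed.

Lemma a_notin_X (n : nat) (n4 : 4 <= n) (L : simple_graph)
    (a : 'I_n -> L) (X : 'I_n -> set L) (HL : is_L n4 a X) i j x :
  X j x -> a i <> x.
Proof.
move=> Xx aix; suff: (range a `&` X j) x by rewrite (L_aX_disj HL).
by split=> //; exists i.
Qed.

Lemma X_neq (n : nat) (n4 : 4 <= n) (L : simple_graph)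
    (a : 'I_n -> L) (X : 'I_n -> set L) (HL : is_L n4 a X) i j x y :
  i <> j -> X i x -> X j y -> x <> y.
Proof.
move=> ij Xx Xy xy; suff: (X i `&` X j) x by rewrite (L_X_disj HL ij).
by split=> //; rewrite xy.
Qed.

Lemma vertex_cases (n : nat) (n4 : 4 <= n) (L : simple_graph)
    (a : 'I_n -> L) (X : 'I_n -> set L) (HL : is_L n4 a X) p :
  (exists i, p = a i) \/ (exists i, X i p).
Proof.
have: [set: L] p by [].
by rewrite -(L_cover HL) => -[[i _ <-]|[i _ Xp]]; [left|right]; exists i.
Qed.

Lemma aX_mul_neq0 (n : nat) (n4 : 4 <= n) (L : simple_graph)
    (a : 'I_n -> L) (X : 'I_n -> set L) (HL : is_L n4 a X)
    (S : magmaType) (zero : S) (v : L -> S)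
    (vP : zero_divisor_labelling zero v) i j x :
  i <> j -> X j x -> v (a i) * v x <> zero.
Proof.
move=> ij Xx /(label_adj vP (a_notin_X HL Xx)).
exact: (L_aXn HL) ij Xx.
Qed.

Lemma XX_mul_neq0 (n : nat) (n4 : 4 <= n) (L : simple_graph)
    (a : 'I_n -> L) (X : 'I_n -> set L) (HL : is_L n4 a X)
    (S : magmaType) (zero : S) (v : L -> S)
    (vP : zero_divisor_labelling zero v) i j x y :
  i <> j -> X i x -> X j y -> v x * v y <> zero.
Proof.
move=> ij Xx Xy /(label_adj vP (X_neq HL ij Xx Xy)).
exact: (L_XX HL) ij Xx Xy.
Qed.

(** All other vertices are distinct from [x] and not adjacent to it, so their
    product with [x] is nonzero. *)
Lemma annihilated_by_X (n : nat) (n4 : 4 <= n) (L : simple_graph)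
    (a : 'I_n -> L) (X : 'I_n -> set L) (HL : is_L n4 a X)
    (S : magmaType) (zero : S) (v : L -> S)
    (vP : zero_divisor_labelling zero v) j x p :
  X j x -> v p * v x = zero -> p = a j \/ X j p.
Proof.
move=> Xx px0; case: (vertex_cases HL p) => -[i pi]; have [ij|/eqP ij] := eqVneq i j.
- by left; rewrite pi ij.
- by case: (aX_mul_neq0 HL vP ij Xx); rewrite -pi.
- by right; rewrite -ij.
- by case: (XX_mul_neq0 HL vP ij pi Xx).
Qed.

Lemma not_annihilated_by_two_X (n : nat) (n4 : 4 <= n) (L : simple_graph)
    (a : 'I_n -> L) (X : 'I_n -> set L) (HL : is_L n4 a X)
    (S : magmaType) (zero : S) (v : L -> S)
    (vP : zero_divisor_labelling zero v) i j x y p :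
  i <> j -> X i x -> X j y -> v p * v x = zero -> v p * v y <> zero.
Proof.
move=> ij Xx Xy px0 py0.
case: (annihilated_by_X HL vP Xx px0) => [pi|Xip];
  case: (annihilated_by_X HL vP Xy py0) => [pj|Xjp].
- by apply: ij; apply: (L_a_inj HL); rewrite -pi.
- exact: a_notin_X HL i _ _ Xjp (esym pi).
- exact: a_notin_X HL j _ _ Xip (esym pj).
- exact: X_neq HL _ _ _ _ ij Xip Xjp erefl.
Qed.

(** An element of some [X k] is annihilated by at most one of the [a i], namely
    [a k]. *)
Lemma annihilated_by_two_a (n : nat) (n4 : 4 <= n) (L : simple_graph)
    (a : 'I_n -> L) (X : 'I_n -> set L) (HL : is_L n4 a X)
    (S : magmaType) (zero : S) (v : L -> S)
    (vP : zero_divisor_labelling zero v) i j p :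
  i <> j -> v (a i) * v p = zero -> v (a j) * v p = zero ->
  exists k, p = a k.
Proof.
move=> ij ip0 jp0; case: (vertex_cases HL p) => // -[k Xp].
have [ik|/eqP ik] := eqVneq i k; last by case: (aX_mul_neq0 HL vP ik Xp).
by case: (aX_mul_neq0 HL vP (i := j) _ Xp) => // jk; apply: ij; rewrite ik jk.
Qed.

(** The vertex [x * a c] would be annihilated by both [y] and any element of
    [X c]. *)
Lemma XXa_mul_neq0 (n : nat) (n4 : 4 <= n) (L : simple_graph)
    (a : 'I_n -> L) (X : 'I_n -> set L) (HL : is_L n4 a X)
    (S : magmaType) (zero : S) (S0 : com_semigroup_with_zero zero)
    (v : L -> S) (vP : zero_divisor_labelling zero v) i j c x y :
  i <> c -> j <> c -> X i x -> X j y -> X c !=set0 ->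
  v x * v y * v (a c) <> zero.
Proof.
move=> ic jc Xx Xy [z Xz] xya0.
have mulA := csz_mulA S0; have mulC := csz_mulC S0.
have xa_y0 : v x * v (a c) * v y = zero by rewrite -mulA (mulC (v (a c))) mulA.
have xa_z0 : v x * v (a c) * v z = zero.
  by rewrite -mulA (label_mul0 vP (L_aX HL Xz)) mulC (csz_mul0 S0).
have xa_neq0 : v x * v (a c) <> zero.
  by rewrite mulC; apply: (aX_mul_neq0 HL vP _ Xx) => /esym.
have [u uE] := label_onto vP xa_neq0 (label_neq0 vP (p := y)) xa_y0.
by apply: (not_annihilated_by_two_X HL vP (p := u) jc Xy Xz); rewrite uE.
Qed.

Theorem theorem3p1 (n : nat) (n4 : 4 <= n) (L : simple_graph)
    (a : 'I_n -> L) (X : 'I_n -> set L) (HL : is_L n4 a X)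
    (S : magmaType) (zero : S) (S0 : com_semigroup_with_zero zero) :
  ~ isomorphic (zero_divisor_graph S0) L.
Proof.
case/isomorphic_labelling=> v vP.
have mulA := csz_mulA S0; have mulC := csz_mulC S0.
pose i1 := Ordinal (ltnW (ltnW (ltnW n4))); pose i2 := Ordinal (ltnW (ltnW n4)).
have i12 : i1 <> i2 by move/(congr1 val).
have [x Xx] : X i1 !=set0 by apply: (L_X_nonempty HL).
have [y Xy] : X i2 !=set0 by apply: (L_X_nonempty HL).
have a1_xy0 : v (a i1) * (v x * v y) = zero.
  by rewrite mulA (label_mul0 vP (L_aX HL Xx)) (csz_mul0 S0).
have a2_xy0 : v (a i2) * (v x * v y) = zero.
  by rewrite (mulC (v x)) mulA (label_mul0 vP (L_aX HL Xy)) (csz_mul0 S0).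
have xy_neq0 := XX_mul_neq0 HL vP i12 Xx Xy.
have [p pE] : exists p, v p = v x * v y.
  by apply: (label_onto vP xy_neq0 (label_neq0 vP (p := a i1))); rewrite mulC.
have [k pk] : exists k, p = a k.
  by apply: (annihilated_by_two_a HL vP i12); rewrite pE.
have xya c : adj (a k) (a c) -> v x * v y * v (a c) = zero.
  by rewrite -pE pk; apply: label_mul0 vP _ _.
case: (L_a34 HL k) => /xya; apply: (XXa_mul_neq0 HL S0 vP _ _ Xx Xy).
1,2,4,5: by move/(congr1 val).
all: exact: (L_X_nonempty HL).
Qed.
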